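(* For every $n\in\mathbb{Z}^+$ and every sequence $S$ of positive integers, there is a bijection between $\mathrm{FR}^{\mathrm{T3}}_{n,S}$ and $\mathrm{UPF}^{\mathrm{T3}}_{n,S}$.
   Context: A Fubini ranking of length $n$ is a tuple $(b_1,\dots,b_n)\in[n]^n$ that satisfies two conditions. First, some $b_i$ equals $1$. Second, for every value $x$ occurring exactly $k>0$ times, the next larger value occurring in the tuple (if there is one) is $x+k$. If it has $k$ distinct values, its position vector is $(c_1,\dots,c_k)$, where $c_i$ is the number of entries equal to $1+c_1+\cdots+c_{i-1}$. $\mathrm{FR}^{\mathrm{T3}}_{n,S}$ (for $S=(s_1,s_2,\dots)$) is the set of Fubini rankings of length $n$ whose position vector satisfies $c_i\le s_i$ for all $i$. A parking preference $(a_1,\dots,a_n)\in[n]^n$ describes $n$ cars entering a one-way street with spots $1,\dots,n$ in the order $1,\dots,n$; car $i$ parks in the first unoccupied spot numbered $\ge a_i$. It is a parking function if all cars park. It is a unit interval parking function if it is a parking function and every car $i$ parks in spot $a_i$ or $a_i+1$. Block structure: let $\alpha^{\uparrow}=(a_1',\dots,a_n')$ be the weakly increasing rearrangement of $\alpha$. The indices $i$ with $a'_i=i$ are block starts; the block structure $\pi_1|\cdots|\pi_k$ cuts $\alpha^{\uparrow}$ into consecutive segments, each beginning at a block start, listed left to right. $\mathrm{UPF}^{\mathrm{T3}}_{n,S}$ is the set of unit interval parking functions of length $n$ with $|\pi_i|\le s_i$ for every block $\pi_i$. *)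

(* Defs.v *)
From mathcomp Require Import all_boot.

Set Implicit Arguments.
Unset Strict Implicit.
Unset Printing Implicit Defensive.

(* Entries of tuples, spots and the indices of block starts are 1-based natural
   numbers, as on paper.  A sequence S = (s_1, s_2, ...) is a function
   s : nat -> nat with s i = s_{i+1}. *)

Definition in_range (n : nat) (a : seq nat) : bool :=
  all (fun x => 1 <= x <= n) a.

Definition next_value (b : seq nat) (x y : nat) : bool :=
  [&& y \in b, x < y & all (fun z => ~~ (x < z < y)) b].

Definition fubini_ranking (n : nat) (b : n.-tuple nat) : bool :=
  [&& in_range n b, 1 \in b &
      all (fun x => all (fun y =>
             next_value b x y ==> (y == x + count_mem x b)) b) b].

(* The next k components of the position vector when the components already
   found sum to p. *)
Fixpoint position_vector_from (b : seq nat) (p k : nat) : seq nat :=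
  if k is k'.+1 then
    let c := count_mem (1 + p) b in c :: position_vector_from b (p + c) k'
  else [::].

Definition position_vector (b : seq nat) : seq nat :=
  position_vector_from b 0 (size (undup b)).

Definition bounded_by (s : nat -> nat) (c : seq nat) : bool :=
  [forall i : 'I_(size c), nth 0 c i <= s i].

Definition FR_T3 (n : nat) (s : nat -> nat) : pred (n.-tuple nat) :=
  fun b => fubini_ranking b && bounded_by s (position_vector b).

(* None means that the car leaves the street without parking. *)
Definition first_free (n : nat) (occ : seq nat) (x : nat) : option nat :=
  ohead [seq j <- iota 1 n | (x <= j) && (j \notin occ)].

Fixpoint park (n : nat) (occ a : seq nat) : seq (option nat) :=
  if a is x :: a' then
    let o := first_free n occ x in
    o :: park n (if o is Some j then j :: occ else occ) a'
  else [::].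

Definition outcome (n : nat) (a : n.-tuple nat) : seq (option nat) :=
  park n [::] a.

Definition parking_function (n : nat) (a : n.-tuple nat) : bool :=
  in_range n a && all isSome (outcome a).

Definition unit_interval_pf (n : nat) (a : n.-tuple nat) : bool :=
  parking_function a &&
  all2 (fun x o => (o == Some x) || (o == Some x.+1)) a (outcome a).

Definition rearrangement (a : seq nat) : seq nat := sort leq a.

Definition block_starts (a : seq nat) : seq nat :=
  [seq i <- iota 1 (size a) | nth 0 (rearrangement a) i.-1 == i].

(* A block with start i ends just before the next block start j, where
   j = size a + 1 for the last block. *)
Definition blocks (a : seq nat) : seq (seq nat) :=
  let starts := block_starts a in
  [seq drop ij.1.-1 (take ij.2.-1 (rearrangement a))
     | ij <- zip starts (rcons (behead starts) (size a).+1)].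

Definition UPF_T3 (n : nat) (s : nat -> nat) : pred (n.-tuple nat) :=
  fun a => unit_interval_pf a && bounded_by s (map size (blocks a)).

(* Main.v *)
Require Import Defs.
From mathcomp Require Import all_boot zify.

(** A Fubini ranking is a tuple [b] in which every entry [x] exceeds by one the
    number of entries smaller than [x].  The bijection replaces the successive
    occurrences of a value [x] by [x, x, x+1, x+2, ...]; the cars of this
    preference list then park in [x, x+1, x+2, x+3, ...].  In a unit interval
    parking function the block starts are exactly the spots whose car gets its
    preferred spot, and a car that misses its preferred spot [p] arrives after
    the car parked in [p].  So the inverse map sends every preference to the
    largest block start below it, and the sizes of the blocks are the
    multiplicities of the values of [b]. *)

Set Implicit Arguments.
Unset Strict Implicit.
Unset Printing Implicit Defensive.

(* [lia] does not identify [nat] with the carrier of its [eqType] structure. *)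
Ltac nat_lia :=
  intros; change (Equality.sort Datatypes_nat__canonical__eqtype_Equality)
    with nat in *; lia.

(** * Counting in sequences *)

(** The entries at most [x] form a prefix of a sorted sequence, so entries of the rearrangement can
    be bounded by counting in the unsorted tuple. *)
Lemma nth_sorted_leq (s : seq nat) (x k : nat) : sorted leq s -> k < size s ->
  (nth 0 s k <= x) = (k < count (fun y => y <= x) s).
Proof.
elim: s k => [|y s IH] //= k ys ks.
have [yx|xy] := leqP y x.
  case: k ks => [|k] ks /=; first by rewrite yx.
  by rewrite add1n ltnS IH // (path_sorted ys).
have all_gt z : z \in s -> x < z.
  by move=> zs; move: ys; rewrite path_sortedE; [move=> /andP[/allP/(_ z zs)]; nat_lia|exact: leq_trans].
rewrite (_ : count _ s = 0); last first.
  apply/eqP; rewrite -leqn0 leqNgt -has_count; apply/hasPn => z /all_gt.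
  by rewrite -ltnNge.
case: k ks => [|k] /= ks; rewrite leqNgt ?xy //.
by rewrite (all_gt _ (mem_nth 0 _)).
Qed.

Lemma count_iota_lt (n i : nat) : 0 < i <= n.+1 ->
  count (fun p => p < i) (iota 1 n) = i.-1.
Proof.
move=> hi; rewrite (_ : n = i.-1 + (n - i.-1)) ?iotaD ?count_cat; last nat_lia.
rewrite (_ : count _ (iota 1 _) = i.-1); last first.
  rewrite -[RHS](size_iota 1) -[RHS]count_predT; apply: eq_in_count => p.
  by rewrite mem_iota /=; nat_lia.
rewrite (_ : count _ (iota (1 + _) _) = 0) ?addn0 //.
apply/eqP; rewrite -leqn0 leqNgt -has_count; apply/hasPn => p.
by rewrite mem_iota; nat_lia.
Qed.

Lemma count_mem_takeP (T : eqType) (x0 x : T) (s : seq T) (c : nat) :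
  c < count_mem x s ->
  exists k, [/\ k < size s, nth x0 s k = x & count_mem x (take k s) = c].
Proof.
elim: s c => [|y s IH] //= c.
have [->|yx] := eqVneq y x.
  case: c => [|c] hc; first by exists 0.
  by have [k [ks kx kc]] := IH c hc; exists k.+1; rewrite /= eqxx kc.
rewrite add0n => /IH [k [ks kx kc]].
by exists k.+1; rewrite /= (negPf yx) kc.
Qed.

Lemma leq_count_take (T : Type) (P : pred T) (s : seq T) (i j : nat) :
  i <= j -> count P (take i s) <= count P (take j s).
Proof. by move=> ij; rewrite -(subnKC ij) takeD count_cat leq_addr. Qed.

Lemma ltn_count_take (T : eqType) (x0 : T) (s : seq T) (i j : nat) :
  i < j -> i < size s ->
  count_mem (nth x0 s i) (take i s) < count_mem (nth x0 s i) (take j s).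
Proof.
move=> ij hi; apply: (@leq_trans (count_mem (nth x0 s i) (take i.+1 s))).
  by rewrite (take_nth x0) // -cats1 count_cat /= eqxx addn1.
exact: leq_count_take.
Qed.

Lemma ltn_count_mem_take (T : eqType) (x0 : T) (s : seq T) (i : nat) :
  i < size s ->
  count_mem (nth x0 s i) (take i s) < count_mem (nth x0 s i) s.
Proof. by move=> hi; rewrite -{4}(take_size s); exact: ltn_count_take. Qed.

(** * Fubini rankings *)

Definition is_ranking (b : seq nat) : bool :=
  all (fun x => x == (count (fun y => y < x) b).+1) b.

Lemma count_leqE (b : seq nat) (x : nat) :
  count (fun y => y <= x) b = count (fun y => y < x) b + count_mem x b.
Proof. by elim: b => //= y b ->; nat_lia. Qed.

Lemma is_rankingE (b : seq nat) (x : nat) : is_ranking b -> x \in b ->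
  x = (count (fun y => y < x) b).+1.
Proof. by move=> /allP rb /rb /eqP. Qed.

(** The rank of [y] counts every entry at most [x], all copies of [x] included. Hence the runs of
    [count_mem x b] spots starting at the values [x] are disjoint. *)
Lemma is_ranking_next (b : seq nat) (x y : nat) : is_ranking b ->
  x \in b -> y \in b -> x < y -> x + count_mem x b <= y.
Proof.
move=> rb xb yb xy; have := is_rankingE rb xb; have := is_rankingE rb yb.
have := count_leqE b x.
have : count (fun z => z <= x) b <= count (fun z => z < y) b.
  by apply: sub_count => z /=; nat_lia.
by nat_lia.
Qed.

Lemma is_ranking_end (b : seq nat) (x : nat) : is_ranking b ->
  x \in b -> x + count_mem x b <= (size b).+1.
Proof.
move=> rb xb; have := is_rankingE rb xb; have := count_leqE b x.
by have := count_size (fun z => z <= x) b; nat_lia.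
Qed.

Lemma is_ranking_range (b : seq nat) (x : nat) : is_ranking b ->
  x \in b -> 0 < x <= size b.
Proof.
move=> rb xb; have := is_rankingE rb xb; have := is_ranking_end rb xb.
have : 0 < count_mem x b by rewrite -has_count has_pred1.
by nat_lia.
Qed.

(** A value other than 1 is the next value of its predecessor [w], and the entries below it are
    those at most [w]; so ranks pass from one value to the next by strong induction. *)
Lemma fubini_rankingE (n : nat) (b : n.-tuple nat) : 0 < n ->
  fubini_ranking b = is_ranking b.
Proof.
move=> n0; apply/idP/idP.
  move=> /and3P[/allP hr h1 /allP hnext]; apply/allP => x.
  elim/ltn_ind: x => x IH xb; apply/eqP.
  have x_gt0 : 0 < x by have := hr _ xb; nat_lia.
  have [x1|x1] := eqVneq x 1.
    rewrite x1; apply/esym; congr S; apply/eqP; rewrite -leqn0 leqNgt -has_count.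
    by apply/hasPn => z /hr; nat_lia.
  have ex_w : exists w, (w \in b) && (w < x).
    by exists 1; rewrite h1 /=; nat_lia.
  have ub_w w : (w \in b) && (w < x) -> w <= x by nat_lia.
  case: (ex_maxnP ex_w ub_w) => w /andP[wb wx] wmax.
  have hall : all (fun z => ~~ (w < z < x)) b.
    by apply/allP => z zb; apply/negP => /andP[wz zx]; have := wmax z; rewrite zb zx; nat_lia.
  have /allP/(_ _ xb) := hnext _ wb.
  rewrite /next_value xb wx hall /= => /eqP xw.
  have /eqP := IH _ wx wb; have := count_leqE b w.
  have -> : count (fun y => y < x) b = count (fun y => y <= w) b.
    by apply: eq_in_count => z /(allP hall); nat_lia.
  move=> /=; nat_lia.
move=> rb; have sb := size_tuple b; apply/and3P; split.
- by apply/allP => x /(is_ranking_range rb); rewrite sb.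
- have ex : exists w, w \in val b.
    by exists (nth 0 b 0); rewrite mem_nth // sb.
  case: (ex_minnP ex) => w wb wmin.
  suff <- : w = 1 by [].
  rewrite (is_rankingE rb wb); congr S; apply/eqP; rewrite -leqn0 leqNgt -has_count.
  by apply/hasPn => z /wmin; rewrite -leqNgt.
- apply/allP => x xb; apply/allP => y yb; apply/implyP => /and3P[_ xy /allP hall].
  have := is_rankingE rb xb; have := is_rankingE rb yb; have := count_leqE b x.
  have -> : count (fun z => z < y) b = count (fun z => z <= x) b.
    by apply: eq_in_count => z /hall; nat_lia.
  by move=> /= *; apply/eqP; nat_lia.
Qed.

(** * Unit interval parking *)

Lemma first_freeP (n : nat) (occ : seq nat) (x j : nat) :
  first_free n occ x = Some j <->
  [/\ 0 < j <= n, x <= j, j \notin occ &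
      forall k, 0 < k -> x <= k < j -> k \in occ].
Proof.
rewrite /first_free.
(* The first spot [m] is generalised because the induction moves the start of [iota]. *)
have H m : ohead [seq k <- iota m n | (x <= k) && (k \notin occ)] = Some j <->
  [/\ m <= j < m + n, x <= j, j \notin occ &
      forall k, m <= k -> x <= k < j -> k \in occ].
  elim: n m => [|n IH] m /=; first by split=> // -[]; nat_lia.
  case: ifPn => /= [/andP[xm mo]|hm].
    split=> [[<-]|[mj xj jo hk]]; first by split=> //; nat_lia.
    have [->//|/eqP mj'] := eqVneq m j.
    by case/negP: mo; apply: hk; nat_lia.
  rewrite IH; split=> -[mj xj jo hk]; split=> //; try nat_lia.
  - move=> k mk xk; have [km|/eqP km] := eqVneq k m; last by apply: hk; nat_lia.
    by move: hm; rewrite -km (_ : x <= k) ?negbK //; nat_lia.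
  - have jm : j <> m by move=> jm; move: hm; rewrite -jm xj jo.
    by nat_lia.
  - by move=> k mk; apply: hk; nat_lia.
by rewrite H; split=> -[? ? ? ?]; split=> //; nat_lia.
Qed.

Lemma eq_first_free (n : nat) (occ occ' : seq nat) (x : nat) : occ =i occ' ->
  first_free n occ x = first_free n occ' x.
Proof. by move=> e; congr ohead; apply: eq_filter => k; rewrite e. Qed.

(** [park] conses the taken spots while [take i o] lists them by arrival; only membership matters to
    [first_free]. *)
Lemma park_someP (n : nat) (occ a o : seq nat) :
  park n occ a = map Some o <->
  size o = size a /\ forall i, i < size a ->
    first_free n (take i o ++ occ) (nth 0 a i) = Some (nth 0 o i).
Proof.
elim: a o occ => [|x a IH] [|y o] occ //=; try by split=> // -[].
split.
  move=> [e]; rewrite e => /IH [so H]; split; first by rewrite so.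
  move=> [|i] //=; rewrite ltnS => /H <-.
  by apply: eq_first_free => k; rewrite in_cons !mem_cat in_cons orbCA.
move=> [[so] H]; have e := H 0 isT; move: e; rewrite /= => e; rewrite e; congr cons.
apply/IH; split=> // i hi; have /= <- := H i.+1 hi.
by apply: eq_first_free => k; rewrite in_cons !mem_cat in_cons orbCA.
Qed.

(** A certificate [o] for a successful run that needs no simulation: a car displaced by one must
    find its preferred spot already taken. *)
Definition unit_parks (a o : seq nat) : Prop :=
  [/\ size o = size a, uniq o, {subset o <= iota 1 (size a)},
      all (fun x => 0 < x) a &
      forall i, i < size a -> nth 0 o i = nth 0 a i \/
        nth 0 o i = (nth 0 a i).+1 /\ nth 0 a i \in take i o].

Lemma notin_take_uniq (T : eqType) (x0 : T) (s : seq T) (i : nat) : uniq s ->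
  i < size s -> nth x0 s i \notin take i s.
Proof. by move=> us hi; rewrite in_take ?mem_nth // index_uniq // ltnn. Qed.

Lemma uniq_nth_take (T : eqType) (x0 : T) (s : seq T) :
  (forall i, i < size s -> nth x0 s i \notin take i s) -> uniq s.
Proof.
elim/last_ind: s => // s x IH H; rewrite rcons_uniq IH ?andbT.
  have := H (size s); rewrite size_rcons nth_rcons ltnn eqxx.
  by rewrite -cats1 take_size_cat //; apply.
move=> i hi; have := H i; rewrite size_rcons nth_rcons hi ltnS (ltnW hi).
by rewrite -cats1 takel_cat ?(ltnW hi) //; apply.
Qed.

Lemma unit_interval_pfP (n : nat) (a : n.-tuple nat) :
  unit_interval_pf a <-> exists o, unit_parks a o.
Proof.
have sa := size_tuple a; split.
  move=> /andP[/andP[/allP hr hs] h2].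
  pose o := pmap id (outcome a).
  have eo : outcome a = map Some o.
    by rewrite /o; elim: (outcome a) hs => //= -[x|] // s IH /= /IH {1}->.
  have /park_someP [so H] := eo; rewrite {hs}eo in h2.
  have {}H i : i < size a ->
      [/\ 0 < nth 0 o i <= n, nth 0 a i <= nth 0 o i, nth 0 o i \notin take i o &
      forall k, 0 < k -> nth 0 a i <= k < nth 0 o i -> k \in take i o].
    by move=> /H; rewrite cats0 => /first_freeP.
  exists o; split=> //.
  - by apply: (@uniq_nth_take _ 0) => i; rewrite so => /H [].
  - move=> x /(nthP 0) [i]; rewrite so => hi <-.
    by rewrite mem_iota sa add1n ltnS; case: (H i hi).
  - by apply/allP => x /hr; nat_lia.
  - move=> i hi; have [_ _ _ hk] := H i hi.
    have : (nth 0 o i == nth 0 a i) || (nth 0 o i == (nth 0 a i).+1).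
      move: h2; rewrite all2E => /andP[_ /(all_nthP (0, None))] /(_ i).
      rewrite size_zip size_map so minnn => /(_ hi).
      rewrite nth_zip ?size_map //= (nth_map 0) ?so //.
    case/orP=> /eqP e; [by left|right; split=> //].
    apply: hk; last by rewrite e leqnn ltnSn.
    by case/andP: (hr _ (mem_nth 0 hi)).
move=> [o [so uo ho /allP ha H]].
have eo : outcome a = map Some o.
  apply/park_someP; split=> // i hi; rewrite cats0; apply/first_freeP.
  have : nth 0 o i \in o by rewrite mem_nth ?so.
  move=> /ho; rewrite mem_iota => hoi; split.
  - by nat_lia.
  - by have := H i hi; nat_lia.
  - by apply: notin_take_uniq; rewrite ?so.
  (* A displaced car passes over a single spot, the preferred one. *)
  - move=> k k0 hk; case: (H i hi) => [e|[e hin]]; first by nat_lia.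
    by rewrite (_ : k = nth 0 a i) //; nat_lia.
rewrite /unit_interval_pf /parking_function eo; apply/andP; split.
  apply/andP; split; last by elim: (o).
  apply/allP => x xa; rewrite (ha _ xa) /=.
  have ia : index x a < size a by rewrite index_mem.
  have : nth 0 o (index x a) \in o by rewrite mem_nth ?so.
  move=> /ho; rewrite mem_iota; have := H _ ia; rewrite nth_index //; nat_lia.
rewrite all2E size_map so eqxx /=; apply/(all_nthP (0, None)) => i.
rewrite size_zip size_map so minnn => hi.
rewrite nth_zip ?size_map //= (nth_map 0) ?so //.
by case: (H i hi) => [->|[-> _]]; rewrite eqxx ?orbT.
Qed.

Section UnitParking.

Variables a o : seq nat.
Hypothesis ao : unit_parks a o.

Let n := size a.

(** Cars are named by the spots they take, since these run through [1..n]. *)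
Definition pref_of (p : nat) : nat := nth 0 a (index p o).

Lemma unit_parks_perm : perm_eq o (iota 1 n).
Proof.
have [so uo ho _ _] := ao.
apply: uniq_perm (iota_uniq _ _) _ => //.
by apply: (uniq_min_size uo ho _).2; rewrite size_iota so.
Qed.

Lemma mem_unit_parks (p : nat) : (p \in o) = (0 < p <= n).
Proof. by rewrite (perm_mem unit_parks_perm) mem_iota; nat_lia. Qed.

Lemma pref_of_nth (i : nat) : i < n -> pref_of (nth 0 o i) = nth 0 a i.
Proof. by have [so uo _ _ _] := ao; move=> hi; rewrite /pref_of index_uniq ?so. Qed.

Lemma map_pref_of : map pref_of o = a.
Proof.
have [so _ _ _ _] := ao.
apply: (@eq_from_nth _ 0); rewrite size_map so // => i hi.
by rewrite (nth_map 0) ?so // pref_of_nth.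
Qed.

Lemma pref_ofP (p : nat) : p \in o -> pref_of p = p \/
  [/\ p = (pref_of p).+1, pref_of p \in o & index (pref_of p) o < index p o].
Proof.
have [so _ _ _ H] := ao; move=> po.
have := H (index p o); rewrite -so index_mem nth_index // => /(_ po).
rewrite -/(pref_of p) => -[e|[e hin]]; first by left.
have qo : pref_of p \in o by exact: mem_take hin.
by right; split=> //; rewrite -in_take.
Qed.

(** A preference is the spot taken or the one before it. So every car parked before [i] counts, none
    parked after [i] does, and only the car in [i] is in doubt. *)
Lemma count_pref_lt (i : nat) : 0 < i <= n ->
  count (fun x => x < i) a = i.-1 + (pref_of i < i).
Proof.
move=> hi; have hio : i \in o by rewrite mem_unit_parks.
rewrite -{1}map_pref_of count_map.
have [so uo _ _ _] := ao.
rewrite -(@count_iota_lt n i) -?(permP unit_parks_perm); last nat_lia.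
(* The bit becomes a count over [o], so that the sum is the count of a disjoint union. *)
have -> : (pref_of i < i) = count (fun p => (p == i) && (pref_of i < i)) o :> nat.
  case: (pref_of i < i).
    rewrite (@eq_count _ _ (pred1 i)) ?count_uniq_mem ?hio // => p.
    by rewrite /= andbT.
  by rewrite (@eq_count _ _ pred0) ?count_pred0 // => p; rewrite andbF.
rewrite -count_predUI [X in _ + X](_ : _ = 0) ?addn0; last first.
  apply/eqP; rewrite -leqn0 leqNgt -has_count; apply/hasPn => p _ /=.
  by nat_lia.
apply: eq_in_count => p po /=.
have [->|/eqP pi] := eqVneq p i; first by rewrite ltnn.
by case: (pref_ofP po) => [|[]]; nat_lia.
Qed.

Lemma count_pref_leq (i : nat) : i <= n -> i <= count (fun x => x <= i) a.
Proof.
move=> hi; rewrite -{1}[i]/(i.+1.-1) -(@count_iota_lt n i.+1) //.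
rewrite -(permP unit_parks_perm) -map_pref_of count_map.
rewrite (@eq_in_count _ _ (fun p => (p < i.+1) && (pref_of p <= i))).
  by apply: sub_count => p /= /andP[].
by move=> p po; case: (pref_ofP po) => [|[]]; nat_lia.
Qed.

(** The sorted entry at index [i.-1] is at most [i], because the cars in the first [i] spots prefer
    at most [i]. It is below [i] exactly when at least [i] preferences are, that is, when the car in
    [i] was displaced. *)
Lemma mem_block_starts (i : nat) :
  (i \in block_starts a) = (0 < i <= n) && (pref_of i == i).
Proof.
rewrite mem_filter mem_iota andbC add1n ltnS; case hi: (0 < i <= _) => //=.
have ss : sorted leq (rearrangement a) by apply: sort_sorted; exact: leq_total.
have cs P : count P (rearrangement a) = count P a.
  by apply/permP; rewrite perm_sort.
have i1 : i.-1 < size (rearrangement a) by rewrite size_sort; nat_lia.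
have := nth_sorted_leq i ss i1; have := nth_sorted_leq i.-1 ss i1.
rewrite !cs; have := @count_pref_leq i; have := count_pref_lt hi.
rewrite (@eq_count _ (fun y => y <= i.-1) (fun y => y < i)); last by move=> y /=; nat_lia.
have := @pref_ofP i; rewrite mem_unit_parks hi => /(_ isT).
by rewrite /n => -[|[]] /=; nat_lia.
Qed.

End UnitParking.

(** * From rankings to preferences *)

(** The truncated predecessor gives the first and second occurrences of a value the same
    preference. *)
Definition prefs_of_ranking (b : seq nat) : seq nat :=
  mkseq (fun i => nth 0 b i + (count_mem (nth 0 b i) (take i b)).-1) (size b).

Definition spots_of_ranking (b : seq nat) : seq nat :=
  mkseq (fun i => nth 0 b i + count_mem (nth 0 b i) (take i b)) (size b).

Lemma nth_prefs_of_ranking (b : seq nat) (i : nat) : i < size b ->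
  nth 0 (prefs_of_ranking b) i =
  nth 0 b i + (count_mem (nth 0 b i) (take i b)).-1.
Proof. by move=> hi; rewrite nth_mkseq. Qed.

Lemma nth_spots_of_ranking (b : seq nat) (i : nat) : i < size b ->
  nth 0 (spots_of_ranking b) i =
  nth 0 b i + count_mem (nth 0 b i) (take i b).
Proof. by move=> hi; rewrite nth_mkseq. Qed.

(** The copies of [x] fill a run of spots from [x] on in order of arrival; [is_ranking_next] keeps
    these runs apart and [is_ranking_end] keeps them within the street. *)
Lemma ranking_unit_parks (b : seq nat) : is_ranking b ->
  unit_parks (prefs_of_ranking b) (spots_of_ranking b).
Proof.
move=> rb; rewrite /unit_parks !size_mkseq; split=> //.
- rewrite map_inj_in_uniq ?iota_uniq // => i j.
  rewrite !mem_iota /= !add0n => hi hj.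
  wlog ij : i j hi hj / nth 0 b i <= nth 0 b j.
    move=> H; case: (leqP (nth 0 b i) (nth 0 b j)) => [ij|/ltnW ij]; first exact: H.
    by move=> e; apply/esym/H.
  have ci := ltn_count_mem_take 0 hi.
  move: ij; rewrite leq_eqVlt => /orP[/eqP e|ij]; last first.
    by have := is_ranking_next rb (mem_nth 0 hi) (mem_nth 0 hj) ij; nat_lia.
  case: (ltngtP i j) => // [ij|ji].
    by have := ltn_count_take 0 ij hi; rewrite e; nat_lia.
  by have := ltn_count_take 0 ji hj; rewrite e; nat_lia.
- move=> x /mapP [i]; rewrite mem_iota => /= hi ->.
  have := ltn_count_mem_take 0 hi; have := is_ranking_end rb (mem_nth 0 hi).
  by have := is_ranking_range rb (mem_nth 0 hi); rewrite mem_iota; nat_lia.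
- apply/allP => x /mapP [i]; rewrite mem_iota => /= hi ->.
  by have := is_ranking_range rb (mem_nth 0 hi); nat_lia.
- move=> i hi; rewrite nth_prefs_of_ranking // nth_spots_of_ranking //.
  case ec: (count_mem _ _) => [|c]; first by left.
  right; split; first by rewrite addnS.
  (* Among the [c.+1] earlier copies, the one preceded by exactly [c] others holds the preferred
     spot. *)
  have := @count_mem_takeP _ 0 (nth 0 b i) (take i b) c.
  rewrite ec => /(_ (leqnn _)) [k []].
  rewrite size_take hi => ki; rewrite nth_take // (take_takel _ (ltnW ki)) => ek ck.
  have kb := ltn_trans ki hi.
  have -> : nth 0 b i + c = nth 0 (take i (spots_of_ranking b)) k.
    by rewrite nth_take // nth_spots_of_ranking // ek ck.
  by rewrite mem_nth // size_take size_mkseq hi.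
Qed.

(** Spot and preference coincide only for the first copy of a value, which parks in the value
    itself. *)
Lemma block_starts_prefs_of_ranking (b : seq nat) : is_ranking b ->
  block_starts (prefs_of_ranking b) = [seq i <- iota 1 (size b) | i \in b].
Proof.
move=> rb; have up := ranking_unit_parks rb; have [_ uo _ _ _] := up.
have := mem_block_starts up; have := mem_unit_parks up.
have := pref_of_nth up; rewrite /block_starts !size_mkseq => hp ho hb.
apply: eq_in_filter => i ii; have := hb i; rewrite mem_filter ii andbT => ->.
have hi : 0 < i <= size b by move: ii; rewrite mem_iota; nat_lia.
rewrite hi /=; have := ho i; rewrite hi => /(nthP 0) [j]; rewrite size_mkseq => hj ej.
apply/eqP/idP => [|ib].
  rewrite -ej hp // nth_prefs_of_ranking // nth_spots_of_ranking //.
  by case: (count_mem _ _) => [|c] /=; [rewrite addn0 mem_nth|nat_lia].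
have ib' : index i b < size b by rewrite index_mem.
have c0 : count_mem i (take (index i b) b) = 0.
  by apply/count_memPn; rewrite in_take // ltnn.
have -> : i = nth 0 (spots_of_ranking b) (index i b).
  by rewrite nth_spots_of_ranking // nth_index // c0 addn0.
rewrite {1}hp // nth_prefs_of_ranking // nth_spots_of_ranking // nth_index //.
by rewrite c0.
Qed.

(* The hypothesis [count (<= p) b = p] says that [p] is a partial sum of the
   position vector, and [r] lists the values of [b] beyond it. *)
Lemma position_vector_fromE (b r : seq nat) (p : nat) : is_ranking b ->
  sorted ltn r -> (forall x, (x \in r) = (x \in b) && (p < x)) ->
  count (fun y => y <= p) b = p ->
  (head (size b).+1 r = p.+1) /\
  position_vector_from b p (size r) =
  [seq minn ij.2.-1 (size b) - ij.1.-1
     | ij <- zip r (rcons (behead r) (size b).+1)].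
Proof.
move=> rb; elim: r p => [|x r IH] p sr memr cp /=.
  split=> //; congr S; rewrite -[RHS]cp -count_predT; apply: eq_in_count => y yb /=.
  by have := memr y; rewrite yb in_nil; nat_lia.
have /andP[xb px] : (x \in b) && (p < x) by rewrite -memr mem_head.
have x_lt y : y \in r -> x < y.
  by move: sr => /=; rewrite path_sortedE; [move=> /andP[/allP H _] /H|exact: ltn_trans].
have x_min y : y \in b -> p < y -> x <= y.
  move=> yb py; have := memr y; rewrite yb py in_cons => /orP[/eqP->//|/x_lt].
  exact: ltnW.
(* As the least value beyond [p], [x] has exactly the [p] entries at most [p] below it; so it is the
   value whose copies are counted next. *)
have ex : x = p.+1.
  rewrite (is_rankingE rb xb) -[in RHS]cp; congr S.
  apply: eq_in_count => y yb; case: (leqP y p) => [yp|/(x_min _ yb)]; nat_lia.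
have cx : 0 < count_mem x b by rewrite -has_count has_pred1.
have [||| hd hv] := IH (p + count_mem x b).
- exact: path_sorted sr.
- move=> y; have := memr y; rewrite in_cons.
  have [->|yx] := eqVneq y x.
    have -> : (x \in r) = false by apply/negP => /x_lt; rewrite ltnn.
    by rewrite (_ : (_ + _ < x) = false) ?andbF //; nat_lia.
  rewrite /= => ->; case yb: (y \in b) => //=.
  apply/idP/idP => h; last by nat_lia.
  have xy : x < y by have := x_min _ yb h; nat_lia.
  by have := is_ranking_next rb xb yb xy; nat_lia.
- have -> : count (fun y => y <= p + count_mem x b) b = count (fun y => y <= x) b.
    apply: eq_in_count => y yb; apply/idP/idP => h; last by nat_lia.
    rewrite leqNgt; apply/negP => xy.
    by have := is_ranking_next rb xb yb xy; nat_lia.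
  rewrite count_leqE; have := is_rankingE rb xb; nat_lia.
have pn : p + count_mem x b <= size b.
  by have := is_ranking_end rb xb; nat_lia.
split=> //; rewrite add1n -ex hv.
(* With its default, [hd] places the end of the current block at [p + count_mem x b], whether or not
   a block follows. *)
case: r hd {IH sr memr x_lt hv} => [|y r] /= hd; congr cons.
  by rewrite minnn; nat_lia.
by rewrite hd /=; nat_lia.
Qed.

Lemma size_blocks_prefs_of_ranking (b : seq nat) : is_ranking b ->
  map size (blocks (prefs_of_ranking b)) = position_vector b.
Proof.
move=> rb; rewrite /blocks block_starts_prefs_of_ranking // size_mkseq -map_comp.
set r := [seq i <- _ | _].
have memr x : (x \in r) = (x \in b) && (0 < x).
  rewrite mem_filter mem_iota; case xb: (x \in b) => //=.
  by have := is_ranking_range rb xb; nat_lia.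
have ur : uniq r by rewrite filter_uniq ?iota_uniq.
have sr : size (undup b) = size r.
  apply/perm_size/uniq_perm => //; first exact: undup_uniq.
  move=> x; rewrite mem_undup memr; case xb: (x \in b) => //=.
  by have := is_ranking_range rb xb; nat_lia.
have [||| _] := @position_vector_fromE b r 0 rb.
- apply: sorted_filter; [exact: ltn_trans|exact: iota_ltn_sorted].
- exact: memr.
- apply/eqP; rewrite -leqn0 leqNgt -has_count; apply/hasPn => x xb.
  by have := is_ranking_range rb xb; nat_lia.
rewrite /position_vector sr => ->; apply: eq_map => -[i j] /=.
rewrite size_drop size_take_min size_sort size_mkseq //.
Qed.

(** * From preferences to rankings *)

Definition floor_in (r : seq nat) (x : nat) : nat := \max_(t <- r | t <= x) t.

(** An empty maximum would be 0; the witness [t] excludes this, and comparison with [ex_maxnP] shows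
    that the maximum is attained in [r]. *)
Lemma floor_inP (r : seq nat) (x t : nat) : t \in r -> t <= x ->
  [/\ floor_in r x \in r, floor_in r x <= x &
      forall u, u \in r -> u <= x -> u <= floor_in r x].
Proof.
move=> tr tx.
have ub u : u \in r -> u <= x -> u <= floor_in r x.
  by move=> ur ux; apply: leq_bigmax_seq.
have [||m /andP[mr mx] hm] := @ex_maxnP (fun u => (u \in r) && (u <= x)) x.
- by exists t; rewrite tr.
- by move=> u /andP[].
suff -> : floor_in r x = m by split=> // u ur ux; apply: hm; rewrite ur.
apply/eqP; rewrite eqn_leq ub // andbT.
by apply/bigmax_leqP_seq => u ur ux; apply: hm; rewrite ur.
Qed.

Definition ranking_of_prefs (a : seq nat) : seq nat :=
  map (floor_in (block_starts a)) a.

(** The preferences made from copies of [x] stay below the next value, so rounding down to a value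
    recovers [x]. *)
Lemma prefs_of_rankingK (b : seq nat) : is_ranking b ->
  ranking_of_prefs (prefs_of_ranking b) = b.
Proof.
move=> rb; apply: (@eq_from_nth _ 0); rewrite size_map size_mkseq // => i hi.
rewrite (nth_map 0) ?size_mkseq // nth_prefs_of_ranking //.
rewrite block_starts_prefs_of_ranking //.
set x := nth 0 b i; have xb : x \in b by rewrite mem_nth.
have cx := ltn_count_mem_take 0 hi; rewrite -/x in cx.
set r := [seq _ <- _ | _].
have xr : x \in r.
  by rewrite mem_filter xb mem_iota; have := is_ranking_range rb xb; nat_lia.
have [|] := @floor_inP r (x + (count_mem x (take i b)).-1) x xr; first nat_lia.
rewrite {1}mem_filter => /andP[yb _] yx /(_ _ xr (leq_addr _ _)).
rewrite leq_eqVlt => /orP[/eqP <-//|xy].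
by have := is_ranking_next rb xb yb xy; nat_lia.
Qed.

Section RankingOfPrefs.

Variables a o : seq nat.
Hypothesis ao : unit_parks a o.

Let L := floor_in (block_starts a).

(** A displaced car in spot 1 would have preferred spot 0, which no car occupies. *)
Lemma mem1_block_starts : 0 < size a -> 1 \in block_starts a.
Proof.
move=> a0; rewrite (mem_block_starts ao) a0 /=.
have := @pref_ofP _ _ ao 1; rewrite !(mem_unit_parks ao) a0 => /(_ isT).
by case=> [|[]]; nat_lia.
Qed.

Lemma block_floorP (p : nat) : p \in o ->
  [/\ L p \in block_starts a, L p <= p &
      forall u, u \in block_starts a -> u <= p -> u <= L p].
Proof.
rewrite (mem_unit_parks ao) => hp; apply: (@floor_inP _ _ 1); last nat_lia.
by apply: mem1_block_starts; nat_lia.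
Qed.

(** A displaced car parks in a spot that is not a block start, so passing from [p.-1] to [p] leaves
    the floor unchanged. *)
Lemma block_floor_eq (p : nat) : p \in o ->
  pref_of a o p = p /\ L p = p \/
  [/\ p = (pref_of a o p).+1, pref_of a o p \in o, L p < p,
      L (pref_of a o p) = L p & index (pref_of a o p) o < index p o].
Proof.
move=> po; have [Ls Lp Lmax] := block_floorP po.
have memp := mem_block_starts ao p; rewrite -(mem_unit_parks ao) po /= in memp.
case: (pref_ofP ao po) => [e|[e qo iq]]; [left|right].
  split=> //; have := Lmax p; rewrite memp e eqxx leqnn => /(_ isT isT); nat_lia.
have pNs : p \notin block_starts a by rewrite memp; apply/eqP; nat_lia.
have Lltp : L p < p.
  rewrite ltn_neqAle Lp andbT; apply/eqP => e'; by rewrite -e' Ls in pNs.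
split=> //; have [Ms Mq Mmax] := block_floorP qo.
by have := Mmax _ Ls; have := Lmax _ Ms; nat_lia.
Qed.

(** Preference and spot lie in the same block; spots, being a permutation of [1..n], are easier to
    count. *)
Lemma ranking_of_prefsE : ranking_of_prefs a = map L o.
Proof.
rewrite /ranking_of_prefs -{2}(map_pref_of ao) -map_comp; apply/eq_in_map => p po /=.
by case: (block_floor_eq po) => [[-> _]|[]].
Qed.

Lemma ranking_of_prefs_ranking : is_ranking (ranking_of_prefs a).
Proof.
rewrite ranking_of_prefsE; apply/allP => x /mapP [p po ->].
have [Ls Lp _] := block_floorP po.
have /andP[hL _] : (0 < L p <= size a) && (pref_of a o (L p) == L p).
  by rewrite -(mem_block_starts ao).
rewrite count_map (@eq_in_count _ _ (fun q => q < L p)); last first.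
  move=> q qo /=; have [Ms Mq Mmax] := block_floorP qo.
  by have := Mmax _ Ls; nat_lia.
by rewrite (permP (unit_parks_perm ao)) count_iota_lt; nat_lia.
Qed.

(* Inside a block the cars park from left to right in order of arrival. *)
Lemma block_arrival_order (p q : nat) : p \in o -> q \in o ->
  L q <= p < q -> index p o < index q o.
Proof.
move=> po; elim/ltn_ind: q => q IH qo pq.
case: (block_floor_eq qo) => [[]|[eq ro Lq Lr ir]]; first by nat_lia.
have [->//|/eqP pr] := eqVneq p (pref_of a o q).
by apply: ltn_trans ir; apply: IH => //; nat_lia.
Qed.

(** By [block_arrival_order], the earlier cars in the block of [q] hold exactly the spots from [L q]
    to [q.-1]. *)
Lemma count_same_block (q : nat) : q \in o ->
  count_mem (L q) (map L (take (index q o) o)) = q - L q.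
Proof.
move=> qo; have [so uo _ _ _] := ao; have [Ls Lq Lmax] := block_floorP qo.
rewrite count_map -size_filter -[RHS](size_iota (L q)).
apply/perm_size/uniq_perm; rewrite ?iota_uniq ?filter_uniq ?take_uniq // => p.
have L0 : 0 < L q by move: Ls; rewrite (mem_block_starts ao); nat_lia.
rewrite mem_filter mem_iota subnKC //; apply/andP/idP.
  move=> [/eqP /= e pt]; have po := mem_take pt; rewrite in_take // in pt.
  have [_ Lp _] := block_floorP po; rewrite -e Lp /= ltnNge.
  apply/negP; rewrite leq_eqVlt => /orP[/eqP e'|qp]; first by move: pt; rewrite e' ltnn.
  by have := @block_arrival_order q p qo po; nat_lia.
move=> hp; have po : p \in o by move: qo; rewrite !(mem_unit_parks ao); nat_lia.
split; last by rewrite in_take // block_arrival_order.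
have [Ms Mp Mmax] := block_floorP po.
by apply/eqP => /=; have := Mmax _ Ls; have := Lmax _ Ms; nat_lia.
Qed.

Lemma ranking_of_prefsK : prefs_of_ranking (ranking_of_prefs a) = a.
Proof.
have [so uo _ _ _] := ao.
apply: (@eq_from_nth _ 0); rewrite size_mkseq size_map // => i hi.
rewrite nth_prefs_of_ranking ?size_map // ranking_of_prefsE (nth_map 0) ?so //.
set q := nth 0 o i; have qo : q \in o by rewrite mem_nth ?so.
have -> : i = index q o by rewrite index_uniq ?so.
rewrite -map_take count_same_block // -/(pref_of a o q).
(* At a block start the truncated predecessor is 0 and the sum is [q]; otherwise it is [q.-1], the
   preference of a displaced car. *)
by have [_ Lq _] := block_floorP qo; case: (block_floor_eq qo) => [[]|[]]; nat_lia.
Qed.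

End RankingOfPrefs.

(** * The two maps on tuples bounded by [s] *)

Lemma UPF_T3_prefs_of_ranking (n : nat) (s : nat -> nat) (b a : n.-tuple nat) :
  val a = prefs_of_ranking b -> FR_T3 s b -> 0 < n -> UPF_T3 s a.
Proof.
move=> ea /andP[rb bb] n0; rewrite fubini_rankingE // in rb.
apply/andP; split; last by rewrite ea size_blocks_prefs_of_ranking.
apply/unit_interval_pfP; exists (spots_of_ranking b).
by rewrite ea; exact: ranking_unit_parks.
Qed.

Lemma FR_T3_ranking_of_prefs (n : nat) (s : nat -> nat) (b a : n.-tuple nat) :
  val b = ranking_of_prefs a -> UPF_T3 s a -> 0 < n -> FR_T3 s b.
Proof.
move=> eb /andP[/unit_interval_pfP [o ao] ba] n0.
have rb : is_ranking b by rewrite eb; exact: ranking_of_prefs_ranking ao.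
apply/andP; split; first by rewrite fubini_rankingE.
by rewrite -size_blocks_prefs_of_ranking // eb (ranking_of_prefsK ao).
Qed.

Theorem theorem5p10 (n : nat) (s : nat -> nat)
    (hn : 0 < n) (hs : forall i : nat, 0 < s i) :
  exists f : {b : n.-tuple nat | FR_T3 s b} -> {a : n.-tuple nat | UPF_T3 s a},
    bijective f.
Proof.
have sf (b : n.-tuple nat) : size (prefs_of_ranking b) == n.
  by rewrite size_mkseq size_tuple.
have sg (a : n.-tuple nat) : size (ranking_of_prefs a) == n.
  by rewrite size_map size_tuple.
have fP (b : n.-tuple nat) : FR_T3 s b -> UPF_T3 s (Tuple (sf b)).
  by move=> hb; apply: (@UPF_T3_prefs_of_ranking n s b).
have gP (a : n.-tuple nat) : UPF_T3 s a -> FR_T3 s (Tuple (sg a)).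
  by move=> ha; apply: (@FR_T3_ranking_of_prefs n s _ a).
pose f (b : {b : n.-tuple nat | FR_T3 s b}) : {a : n.-tuple nat | UPF_T3 s a} :=
  exist _ (Tuple (sf (sval b))) (fP _ (svalP b)).
pose g (a : {a : n.-tuple nat | UPF_T3 s a}) : {b : n.-tuple nat | FR_T3 s b} :=
  exist _ (Tuple (sg (sval a))) (gP _ (svalP a)).
(* The two uses of [val_inj] strip the subset proof and the tuple size proof, leaving equations
   between sequences. *)
exists f; exists g => [[b hb]|[a ha]]; do 2 apply: val_inj => /=.
  by apply: prefs_of_rankingK; move: hb => /andP[+ _]; rewrite fubini_rankingE.
by move: ha => /andP[/unit_interval_pfP [o ao] _]; exact: ranking_of_prefsK ao.
Qed.
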